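(* Let $n_1\ge n_2\ge 1$ be integers. For any $\theta\in\mathcal{M}^{n_1,n_2}$ and any positive integer $r$, there exists a matrix $\tilde\theta\in\mathbb{R}^{n_1\times n_2}$ of rank at most $3r+3$ such that $$\|\tilde\theta-\theta\|_F^2\le 2\,\frac{n_1n_2}{r^3}\,V(\theta)^2.$$
   Context: A matrix $\theta\in\mathbb{R}^{n_1\times n_2}$ is anti-Monge if $\theta_{i,j}+\theta_{k,\ell}\ge\theta_{i,\ell}+\theta_{k,j}$ for all $1\le i\le k\le n_1$, $1\le j\le\ell\le n_2$; the set of such matrices is $\mathcal{M}^{n_1,n_2}$. For $\theta\in\mathcal{M}^{n_1,n_2}$, $V(\theta):=\theta_{1,1}+\theta_{n_1,n_2}-\theta_{n_1,1}-\theta_{1,n_2}$. $\|\cdot\|_F$ is the Frobenius norm. *)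

(* Defs.v *)
From mathcomp Require Import all_boot all_order all_algebra.
From mathcomp Require Import reals.

Set Implicit Arguments.
Unset Strict Implicit.
Unset Printing Implicit Defensive.

Import Order.TTheory GRing.Theory Num.Theory.
Local Open Scope ring_scope.

Definition anti_monge (R : realType) (m n : nat) (theta : 'M[R]_(m, n)) : Prop :=
  forall (i k : 'I_m) (j l : 'I_n), (i <= k)%N -> (j <= l)%N ->
    theta i l + theta k j <= theta i j + theta k l.

(* Indices start at 0, so the corners have coordinates ord0 and ord_max; the
   successor dimensions make them exist. *)
Definition variation (R : realType) (m n : nat) (theta : 'M[R]_(m.+1, n.+1)) : R :=
  theta ord0 ord0 + theta ord_max ord_max
  - theta ord_max ord0 - theta ord0 ord_max.

(* The norm `|A| that MathComp-Analysis puts on matrices is the max norm. *)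
Definition frobenius_norm (R : realType) (m n : nat) (A : 'M[R]_(m, n)) : R :=
  Num.sqrt (\sum_i \sum_j A i j ^+ 2).

(* Main.v *)
(** Choose a row map [a] and a column map [b] sending every index to the left
    end of its block in a partition of the index range into intervals, and set
    [theta' i j = theta (a i) j + theta i (b j) - theta (a i) (b j)].  Its rank is
    at most the number of row blocks plus the number of column blocks, and the
    error at [(i, j)] is the mass [D i j >= 0] which the anti-Monge increments of
    [theta] give to the rectangle [(a i, i] x (b j, j]].  With at most [r]
    column blocks and fewer than [2 r] row blocks of mass at most [V / r], all of
    length at most [n / r] beyond their left end, [D i j <= V / r] while the sum of
    [D] is at most [n1 n2 V / r^2]; so the sum of [D ^ 2] is at most
    [n1 n2 V^2 / r^3]. *)
Require Import Defs.
From mathcomp Require Import all_boot all_order all_algebra.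
From mathcomp Require Import reals zify ring lra.

Set Implicit Arguments.
Unset Strict Implicit.
Unset Printing Implicit Defensive.

Import Order.TTheory GRing.Theory Num.Theory.
Local Open Scope ring_scope.

(** The selection factors through the [size t] rows listed in [t], on the left by a 0/1 matrix
    locating each [a i] in [t]. *)
Lemma mxrank_rowsub_le (F : fieldType) (m n p : nat) (A : 'M[F]_(m, n))
    (a : 'I_p -> 'I_m) (t : seq 'I_m) :
  (forall i, a i \in t) -> (\rank (rowsub a A) <= size t)%N.
Proof.
move=> at_.
pose B := \matrix_(i < p, k < size t) (index (a i) t == k)%:R : 'M[F]_(p, size t).
suff -> : rowsub a A = B *m rowsub (tnth (in_tuple t)) A by exact: mulmx_max_rank.
apply/matrixP => i j; rewrite !mxE.
have lt_i : (index (a i) t < size t)%N by rewrite index_mem.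
rewrite (bigD1 (Ordinal lt_i)) //= big1 => [|k /negbTE nk].
  by rewrite !mxE eqxx mul1r addr0 (tnth_nth (a i)) /= nth_index.
by rewrite !mxE (_ : (_ == _) = false) ?mul0r // eq_sym -nk.
Qed.

Lemma mxrank_colsub_le (F : fieldType) (m n p : nat) (A : 'M[F]_(m, n))
    (b : 'I_p -> 'I_n) (t : seq 'I_n) :
  (forall j, b j \in t) -> (\rank (colsub b A) <= size t)%N.
Proof.
by move=> bt; rewrite -mxrank_tr trmx_mxsub; exact: mxrank_rowsub_le.
Qed.

(* [cut x n] decides whether [n] opens a new block when [x] opened the current
   one; block openings are listed most recent first. *)
Fixpoint block_starts (cut : nat -> nat -> bool) (n : nat) : seq nat :=
  if n is p.+1 then
    let t := block_starts cut p in if cut (head 0%N t) n then n :: t else t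
  else [:: 0%N].

Definition block_start cut n := head 0%N (block_starts cut n).

Section BlockStart.

Variable cut : nat -> nat -> bool.

Lemma block_startS n :
  block_start cut n.+1 =
    if cut (block_start cut n) n.+1 then n.+1 else block_start cut n.
Proof. by rewrite /block_start /=; case: ifP. Qed.

Lemma block_start_le n : (block_start cut n <= n)%N.
Proof.
by elim: n => // n IHn; rewrite block_startS; case: ifP => // _; exact: leqW.
Qed.

Lemma block_start_uncut n :
  (forall x, cut x x = false) -> cut (block_start cut n) n = false.
Proof.
move=> cutxx; case: n => [|n]; first exact: cutxx.
by rewrite block_startS; case: ifP.
Qed.

Lemma block_start_mem i n : (i <= n)%N -> block_start cut i \in block_starts cut n.
Proof.
elim: n => [|n IHn].
  by rewrite leqn0 => /eqP ->; rewrite /block_start /= inE.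
rewrite leq_eqVlt => /predU1P[->|/IHn mem_i].
  rewrite /block_start /=; case: ifP => _; first exact: mem_head.
  case: n {IHn} => [|n] /=; first exact: mem_head.
  have: block_starts cut n != [::].
    by elim: n => // n IHn /=; case: ifP.
  by case: ifP => _; case: (block_starts cut n) => //= *; exact: mem_head.
by rewrite /=; case: ifP => // _; rewrite inE mem_i orbT.
Qed.

(* The term [(n - x) * (g n - g x)], [x] the start of the current unfinished
   block, is what makes the induction on [n] go through. *)
Lemma sum_block_increments (R : realDomainType) (g : nat -> R) (q n : nat) :
  (forall i j, (i <= j <= n)%N -> g i <= g j) ->
  (forall i, (i - block_start cut i <= q)%N) ->
  \sum_(i < n.+1) (g i - g (block_start cut i)) <= q%:R * (g n - g 0%N).
Proof.
move=> g_mono lenq.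
suff sum_le : \sum_(i < n.+1) (g i - g (block_start cut i)) <=
    q%:R * (g (block_start cut n) - g 0%N)
    + (n - block_start cut n)%:R * (g n - g (block_start cut n)).
  apply: (le_trans sum_le).
  have : g (block_start cut n) <= g n by rewrite g_mono // block_start_le leqnn.
  have : (n - block_start cut n)%:R <= q%:R :> R by rewrite ler_nat.
  by nra.
elim: n g_mono => [|n IHn] g_mono.
  by rewrite big_ord_recr big_ord0 /block_start /= !subrr !mulr0 addr0.
rewrite big_ord_recr /=.
have /IHn {}IHn : forall i j, (i <= j <= n)%N -> g i <= g j.
  by move=> i j /andP[ij jn]; rewrite g_mono // ij leqW.
have le_x := block_start_le n.
have x_n : g (block_start cut n) <= g n by rewrite g_mono // le_x leqnSn.
have n_n1 : g n <= g n.+1 by rewrite g_mono // leqnn leqnSn.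
have len_n : (n - block_start cut n)%:R <= q%:R :> R by rewrite ler_nat.
(* If a block opens at [n.+1], the pending weight is at most [q] and is absorbed by the main term;
   otherwise the new summand raises that weight by one. *)
rewrite block_startS; case: ifP => _.
  rewrite !subrr mulr0 !addr0; apply: (le_trans IHn).
  have : (n - block_start cut n)%:R * (g n - g (block_start cut n))
      <= q%:R * (g n.+1 - g (block_start cut n)).
    by apply: ler_pM; rewrite ?ler0n ?subr_ge0 ?lerB.
  by lra.
have : (n - block_start cut n)%:R * (g n - g (block_start cut n))
    <= (n - block_start cut n)%:R * (g n.+1 - g (block_start cut n)).
  by rewrite ler_wpM2l ?ler0n ?lerB.
by rewrite subSn // -natr1; lra.
Qed.

End BlockStart.

(* [k] counts the cuts caused by the length of the current block, [l] those
   caused by its mass. *)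
Lemma size_bounded_blocks (R : realDomainType) (f : nat -> R) (q s : nat) (V : R)
    (n : nat) (cut := fun x i => (q < i - x)%N || (V < s%:R * (f i - f x))) :
  (forall i j, (i <= j <= n)%N -> f i <= f j) ->
  exists k l : nat,
    [/\ size (block_starts cut n) = (k + l).+1,
        (k * q.+1 <= block_start cut n)%N
      & l = 0%N \/ l%:R * V < s%:R * (f (block_start cut n) - f 0%N)].
Proof.
(* With [l = 0] the strict inequality would read [0 < 0] here, hence the alternative; strictness
   later gives [l < s]. *)
elim: n => [|n IHn] f_mono; first by exists 0%N, 0%N; split=> //; left.
have /IHn[k [l [size_n kq lV]]] : forall i j, (i <= j <= n)%N -> f i <= f j.
  by move=> i j /andP[ij jn]; rewrite f_mono // ij leqW.
have le_x := block_start_le cut n.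
have x_n1 : s%:R * f (block_start cut n) <= s%:R * f n.+1.
  by rewrite ler_wpM2l ?ler0n // f_mono // leqnn leqW.
have x_0 : s%:R * f 0%N <= s%:R * f (block_start cut n).
  by rewrite ler_wpM2l ?ler0n // f_mono //= leqW.
rewrite block_startS /= -/(block_start cut n); case: ifP; last by exists k, l.
(* A cut that is both long and heavy counts as long. *)
rewrite {1}/cut; case: (ltnP q (n.+1 - block_start cut n)) => /= [long _|_ heavy].
- exists k.+1, l; split=> /=; [by rewrite size_n | by rewrite mulSn; lia |].
  by case: lV => [|lV]; [left | right; lra].
- exists k, l.+1; split=> /=; [by rewrite size_n addnS | by lia |].
  by right; rewrite -natr1; case: lV => [->|]; lra.
Qed.

(** The last clause depends only on block lengths, so it holds for every monotone [g], not just the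
    [f] that fixed the blocks. *)
Lemma exists_bounded_blocks (R : realDomainType) (m r s : nat) (f : 'I_m.+1 -> R) :
  (0 < r)%N -> (0 < s)%N ->
  {homo f : i j / (i <= j)%N >-> i <= j} ->
  exists (a : 'I_m.+1 -> 'I_m.+1) (t : seq 'I_m.+1),
    [/\ (size t < r + s)%N, forall i, a i \in t, forall i, (a i <= i)%N,
        forall i, s%:R * (f i - f (a i)) <= f ord_max - f ord0
      & forall g : 'I_m.+1 -> R, {homo g : i j / (i <= j)%N >-> i <= j} ->
          r%:R * \sum_i (g i - g (a i)) <= m.+1%:R * (g ord_max - g ord0)].
Proof.
move=> r_gt0 s_gt0 f_mono.
have mono_inord (g : 'I_m.+1 -> R) : {homo g : i j / (i <= j)%N >-> i <= j} ->
    forall i j, (i <= j <= m)%N -> g (inord i) <= g (inord j).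
  move=> g_mono i j /andP[ij jm]; apply: g_mono.
  by rewrite !inordK // ltnS // (leq_trans ij).
have inord_m : inord m = ord_max :> 'I_m.+1 by apply: val_inj; rewrite /= inordK.
have inord_0 : inord 0 = ord0 :> 'I_m.+1 by apply: val_inj; rewrite /= inordK.
(* Rounding down gives [r * q <= m.+1], while [m.+1 < r * q.+1] leaves room for fewer than [r]
   length cuts. *)
pose q := (m.+1 %/ r)%N; pose V := f ord_max - f ord0.
have V_ge0 : 0 <= V by rewrite subr_ge0 f_mono.
pose F (i : nat) := f (inord i).
pose cut x i := (q < i - x)%N || (V < s%:R * (F i - F x)).
have cutxx x : cut x x = false by rewrite /cut subnn subrr mulr0 ltNge V_ge0.
have uncut i : cut (block_start cut i) i = false by exact: block_start_uncut.
pose a (i : 'I_m.+1) : 'I_m.+1 := inord (block_start cut i).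
have val_a i : a i = block_start cut i :> nat.
  by rewrite inordK // (leq_ltn_trans (block_start_le _ _)).
exists a, (map inord (block_starts cut m)); split.
- have [k [l [size_n kq lV]]] := size_bounded_blocks q s V (mono_inord f f_mono).
  rewrite size_map [size _]size_n.
  have k_lt : (k < r)%N.
    have := leq_trans kq (block_start_le _ m); have := ltn_ceil m.+1 r_gt0.
    by rewrite -/q; nia.
  have l_lt : (l < s)%N.
    case: lV => [->//|]; apply: contraTT; rewrite -leqNgt -leNgt => s_l.
    have le_V : F (block_start cut m) - F 0%N <= V.
      by rewrite /V -inord_0 -inord_m lerB // mono_inord // block_start_le leqnn.
    apply: (le_trans (ler_wpM2l (ler0n _ _) le_V)).
    by rewrite ler_wpM2r // ler_nat.
  by lia.
- by move=> i; apply: map_f; apply: block_start_mem; rewrite -ltnS.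
- by move=> i; rewrite val_a block_start_le.
- move=> i; have /negbT := uncut i; rewrite negb_or => /andP[_].
  by rewrite -leNgt /F inord_val.
- move=> g g_mono.
  have lenq i : (i - block_start cut i <= q)%N.
    by have /negbT := uncut i; rewrite negb_or -leqNgt => /andP[].
  have := sum_block_increments (mono_inord g g_mono) lenq.
  rewrite inord_m inord_0 (eq_bigr (fun i => g i - g (a i))) => [sum_le|i _]; last first.
    by rewrite inord_val.
  apply: (le_trans (ler_wpM2l (ler0n _ _) sum_le)).
  rewrite mulrA ler_wpM2r ?subr_ge0 ?g_mono //.
  by rewrite -natrM ler_nat mulnC leq_divM.
Qed.

(* The dimensions are n1 = m1.+1 and n2 = m2.+1. *)
Theorem proposition6 (R : realType) (m1 m2 : nat) (hm : (m2.+1 <= m1.+1)%N)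
    (theta : 'M[R]_(m1.+1, m2.+1)) (htheta : anti_monge theta)
    (r : nat) (hr : (0 < r)%N) :
  exists theta' : 'M[R]_(m1.+1, m2.+1),
    (\rank theta' <= 3 * r + 3)%N /\
    frobenius_norm (theta' - theta) ^+ 2
      <= 2 * ((m1.+1%:R * m2.+1%:R) / r%:R ^+ 3) * variation theta ^+ 2.
Proof.
pose h i := theta i ord_max - theta i ord0.
have h_mono : {homo h : i k / (i <= k)%N >-> i <= k}.
  by move=> i k ik; have := htheta i k ord0 ord_max ik isT; rewrite /h; lra.
have [a [t [size_t at_ a_le mass_a sum_a]]] := exists_bounded_blocks hr hr h_mono.
(* Column blocks need no mass bound: a zero mass makes it void, and [s = 1] leaves
   only [r] blocks. *)
have [|b [u [size_u bu b_le _ sum_b]]] :=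
    @exists_bounded_blocks R m2 r 1 (fun=> 0) hr isT; first by [].
pose D i j := theta i j - theta (a i) j - theta i (b j) + theta (a i) (b j).
set V := variation theta.
have V_def : h ord_max - h ord0 = V by rewrite /V /variation /h; ring.
have V_ge0 : 0 <= V by rewrite -V_def subr_ge0 h_mono.
have D_ge0 i j : 0 <= D i j.
  by have := htheta _ _ _ _ (a_le i) (b_le j); rewrite /D; lra.
have D_le i j : r%:R * D i j <= V.
  rewrite -V_def; apply: le_trans (mass_a i); rewrite ler_wpM2l ?ler0n //.
  (* Widen the columns to the full range: the strips right of [j] and left of [b j] have nonnegative
     mass. *)
  have := htheta _ _ j ord_max (a_le i) (leq_ord j).
  have := htheta _ _ ord0 (b j) (a_le i) isT.
  by rewrite /D /h; lra.
have sum_D : r%:R ^+ 2 * (\sum_i \sum_j D i j) <= m1.+1%:R * m2.+1%:R * V.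
  (* Each direction gains a factor [1 / r]: [sum_a] applies to [G], whose total increment is a
     column sum for [e], ready for [sum_b]. *)
  pose G i := \sum_j (theta i j - theta i (b j)).
  have G_mono : {homo G : i k / (i <= k)%N >-> i <= k}.
    move=> i k ik; apply: ler_sum => j _.
    by have := htheta _ _ _ _ ik (b_le j); lra.
  pose e j := theta ord_max j - theta ord0 j.
  have e_mono : {homo e : j l / (j <= l)%N >-> j <= l}.
    by move=> j l jl; have := htheta ord0 ord_max _ _ isT jl; rewrite /e; lra.
  have -> : \sum_i \sum_j D i j = \sum_i (G i - G (a i)).
    apply: eq_bigr => i _; rewrite /G -sumrB; apply: eq_bigr => j _.
    by rewrite /D; ring.
  have G_e : G ord_max - G ord0 = \sum_j (e j - e (b j)).
    by rewrite /G -sumrB; apply: eq_bigr => j _; rewrite /e; ring.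
  have V_e : e ord_max - e ord0 = V by rewrite /V /variation /e; ring.
  rewrite expr2 -mulrA; apply: (le_trans (ler_wpM2l (ler0n _ _) (sum_a _ G_mono))).
  rewrite mulrCA -mulrA ler_wpM2l ?ler0n //.
  by rewrite G_e -V_e; exact: sum_b.
exists (rowsub a theta + colsub b (theta - rowsub a theta)); split.
  (* At most [2r - 1] listed rows and [r] listed columns. *)
  apply: (leq_trans (mxrank_add _ _)).
  apply: leq_trans (leq_add (mxrank_rowsub_le _ at_) (mxrank_colsub_le _ bu)) _.
  by lia.
rewrite sqr_sqrtr; last by do 2![apply: sumr_ge0 => ? _]; exact: sqr_ge0.
rewrite (eq_bigr (fun i => \sum_j D i j ^+ 2)) => [|i _]; last first.
  by apply: eq_bigr => j _; rewrite !mxE /D; ring.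
have r_gt0 : 0 < r%:R :> R by rewrite ltr0n.
have sum_sqr : r%:R ^+ 3 * (\sum_i \sum_j D i j ^+ 2) <= m1.+1%:R * m2.+1%:R * V ^+ 2.
  (* One factor of each square is bounded by [V / r], the other is kept for [sum_D]. *)
  have : r%:R * (\sum_i \sum_j D i j ^+ 2) <= V * (\sum_i \sum_j D i j).
    rewrite !mulr_sumr; apply: ler_sum => i _.
    rewrite !mulr_sumr; apply: ler_sum => j _.
    by rewrite expr2 mulrA ler_wpM2r.
  move/(ler_wpM2l (exprn_ge0 2 (ltW r_gt0))); rewrite mulrA -exprSr => /le_trans.
  by apply; rewrite mulrCA [leLHS]mulrC [V ^+ 2]expr2 [leRHS]mulrA ler_wpM2r.
have main : \sum_i \sum_j D i j ^+ 2 <= m1.+1%:R * m2.+1%:R / r%:R ^+ 3 * V ^+ 2.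
  by rewrite mulrAC ler_pdivlMr ?exprn_gt0 // mulrC.
apply: (le_trans main); rewrite -[leRHS]mulrA ler_peMl ?ler1n //.
by rewrite mulr_ge0 ?sqr_ge0 // divr_ge0 ?mulr_ge0 ?exprn_ge0 ?ler0n.
Qed.
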